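(* Let $\mathsf k$ be a field of characteristic $0$, $n\ge 1$, and let $M$ be a finite-dimensional representation of $S_{n+1}$ over $\mathsf k$. Let $\mathsf k_\epsilon$ be the sign representation of $S_{n+1}$. Then there is an isomorphism $$\mathrm{FT}(\mathcal Q_M)\simeq \mathcal Q_{M\otimes \mathsf k_\epsilon}$$ in $\mathrm{Hyp}^{\mathrm{ass}}_n(\mathrm{Rep}(S_{n+1}))$.
   Context: Write $[n]=\{1,\dots,n\}$ and $\overline I=[n]\setminus I$ for $I\subset[n]$. Cells. The coordinate hyperplanes of $\mathbb R^n$ stratify it into $3^n$ cells $C_{(I,\epsilon)}$, $I\subset[n]$, $\epsilon=(\epsilon_j)\in\{1,-1\}^{\overline I}$, where $C_{(I,\epsilon)}=\{x: x_i=0 \text{ for } i\in I,\ \epsilon_jx_j>0\text{ for }j\notin I\}$. Put $C\le C'$ if $C$ lies in the closure of $C'$; thus $C_{(I,\epsilon)}\le C_{(I',\epsilon')}$ iff $I\supset I'$ and $\epsilon_j=\epsilon'_j$ for all $j\in\overline I$. Let $C_I$ be the cell with all $\epsilon_j=1$. Bisheaves. A bisheaf on the poset of cells with values in a category $\mathcal C$ is a collection of objects $E(C)\in\mathcal C$ with maps $\gamma_{CC'}:E(C)\to E(C')$ and $\delta_{C'C}:E(C')\to E(C)$ for $C\le C'$, with $\gamma$ (resp. $\delta$) functorial (resp. contravariantly functorial) on the poset. Morphisms are families of maps commuting with all $\gamma$ and $\delta$. Amonodromic semisimple sheaves. Let $\mathcal C$ be a semisimple abelian category. $\mathrm{GGM}^{\mathrm{ass}}_n(\mathcal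 C)$ is the category of families $\Phi=(\Phi(I))_{I\subset[n]}$ of objects of $\mathcal C$. Let $Q$ send $\Phi$ to the bisheaf with $E(C_{(I,\epsilon)})=\bigoplus_{J\subset I}\Phi(J)$, with $\gamma$ the natural projections onto direct summands and $\delta$ the natural embeddings of direct summands. $\mathrm{Hyp}^{\mathrm{ass}}_n(\mathcal C)$ is the full subcategory of bisheaves isomorphic to some $Q(\Phi)$; $Q:\mathrm{GGM}^{\mathrm{ass}}_n(\mathcal C)\to\mathrm{Hyp}^{\mathrm{ass}}_n(\mathcal C)$ is an equivalence with quasi-inverse $P$ sending $E$ to $\Phi(I)=\bigcap_{J\subsetneq I}\mathrm{Ker}\,\gamma_{C_IC_J}$ (with $\Phi(\emptyset)=E(C_\emptyset)$). The Fourier–Sato transform on $\mathrm{GGM}^{\mathrm{ass}}_n(\mathcal C)$ is $(\Phi(I))_I\mapsto(\Phi(\overline I))_I$, and $\mathrm{FT}$ on $\mathrm{Hyp}^{\mathrm{ass}}_n(\mathcal C)$ is the autoequivalence corresponding to it under $P,Q$. The sheaf $\mathcal Q$. Let $\mathrm{Rep}(S_{n+1})$ be the category of finite-dimensional $\mathsf k[S_{n+1}]$-modules and $s_i=(i\ i{+}1)$. For $I\subset[n]$ let $W_I=\langle s_i: i\in I\rangle\subset S_{n+1}$, $a_I=\sum_{w\in W_I}w$, $b_I=\sum_{w\in W_I}\mathrm{sgn}(w)w$, and let $R_I=\mathsf k[S_{n+1}]\,b_Ia_{\overline I}$ (the ribbon module, a left ideal). Then $\mathcal Q:=Q((R_I)_{I\subset[n]})$,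 i.e. $\mathcal Q(C_{(I,\epsilon)})=\bigoplus_{J\subset I}R_J$. For $M\in\mathrm{Rep}(S_{n+1})$, $\mathcal Q_M$ is the bisheaf with stalks $M\otimes\mathcal Q(C_{(I,\epsilon)})$ (diagonal action) and maps $\mathrm{Id}_M\otimes\gamma$, $\mathrm{Id}_M\otimes\delta$. *)

(* Defs.v *)
From HB Require Import structures.
From mathcomp Require Import all_boot all_order all_fingroup all_algebra.

Set Implicit Arguments.
Unset Strict Implicit.
Unset Printing Implicit Defensive.

Import GRing.Theory.
Local Open Scope ring_scope.

(* dsum V A is the direct sum of the V i over the i satisfying A. *)
Section DirectSum.
Variables (k : fieldType) (T : finType) (V : T -> vectType k).

Definition dsum (A : pred T) : Type := {dffun forall i : {i | A i}, V (val i)}.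

Section Structure.
Variable A : pred T.
Implicit Types f g h : dsum A.

HB.instance Definition _ := Choice.on (dsum A).

Definition ds_zero : dsum A := [ffun i => 0].
Definition ds_opp f : dsum A := [ffun i => - f i].
Definition ds_add f g : dsum A := [ffun i => f i + g i].
Definition ds_scale (a : k) f : dsum A := [ffun i => a *: f i].

Fact ds_addA : associative ds_add.
Proof. by move=> f g h; apply/ffunP => i; rewrite !ffunE addrA. Qed.
Fact ds_addC : commutative ds_add.
Proof. by move=> f g; apply/ffunP => i; rewrite !ffunE addrC. Qed.
Fact ds_add0 : left_id ds_zero ds_add.
Proof. by move=> f; apply/ffunP => i; rewrite !ffunE add0r. Qed.
Fact ds_addN : left_inverse ds_zero ds_opp ds_add.
Proof. by move=> f; apply/ffunP => i; rewrite !ffunE addNr. Qed.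
HB.instance Definition _ :=
  GRing.isZmodule.Build (dsum A) ds_addA ds_addC ds_add0 ds_addN.

Fact ds_scaleA a b f : ds_scale a (ds_scale b f) = ds_scale (a * b) f.
Proof. by apply/ffunP => i; rewrite !ffunE scalerA. Qed.
Fact ds_scale1 : left_id 1 ds_scale.
Proof. by move=> f; apply/ffunP => i; rewrite !ffunE scale1r. Qed.
Fact ds_scaleDr : right_distributive ds_scale +%R.
Proof. by move=> a f g; apply/ffunP => i; rewrite !ffunE scalerDr. Qed.
Fact ds_scaleDl f : {morph ds_scale^~ f : a b / a + b}.
Proof. by move=> a b; apply/ffunP => i; rewrite !ffunE scalerDl. Qed.
HB.instance Definition _ := GRing.Zmodule_isLmodule.Build k (dsum A)
  ds_scaleA ds_scale1 ds_scaleDr ds_scaleDl.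

Lemma ds_linE a f g i : (a *: f + g) i = a *: f i + g i.
Proof. by rewrite !ffunE. Qed.

Let d (j : 'I_#|{: {i | A i}}|) := dim (V (val (enum_val j))).

Import VectorInternalTheory.
Fact dsum_vect_iso : Vector.axiom (\sum_j d j) (dsum A).
Proof.
pose F (f : dsum A) := \mxrow_j (v2r (f (enum_val j)) : 'rV_(d j)).
have lF : linear F.
  move=> a f g; apply/mxrowP => j.
  rewrite submxrowD mxrowK ds_linE linearP /=.
  have -> : submxrow (a *: F f) j = a *: submxrow (F f) j.
    by apply/matrixP => x y; rewrite !mxE.
  by rewrite !mxrowK.
exists F => //.
pose G0 (r : 'rV_(\sum_j d j)) (j : 'I_#|{: {i | A i}}|) :
  V (val (enum_val j)) := @r2v k (V (val (enum_val j))) (submxrow r j).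
pose G (r : 'rV_(\sum_j d j)) : dsum A :=
  [ffun i => ecast i (V (val i)) (enum_rankK i) (G0 r (enum_rank i))].
have GE r j : G r (enum_val j) = G0 r j.
  rewrite ffunE; move: (enum_rankK _); rewrite enum_valK => e.
  by rewrite (eq_axiomK e).
exists G => [f|r].
  by apply/ffunP => i; rewrite -(enum_rankK i) GE /G0 mxrowK v2rK.
by apply/mxrowP => j; rewrite mxrowK GE r2vK.
Qed.
HB.instance Definition _ := Lmodule_hasFinDim.Build k (dsum A) dsum_vect_iso.

End Structure.

(* The component of f at j, which is 0 when j is not an index of f. *)
Definition ds_comp (A : pred T) (f : dsum A) (j : T) : V j :=
  match @idP (A j) with
  | ReflectT Aj => f (exist _ j Aj)
  | ReflectF _ => 0
  end.

Lemma ds_comp_val A (f : dsum A) (i : {i | A i}) : ds_comp f (val i) = f i.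
Proof.
case: i => j Aj; rewrite /ds_comp /=.
by destruct idP as [Aj'|]; rewrite // (bool_irrelevance Aj' Aj).
Qed.

Lemma ds_comp_out A (f : dsum A) j : ~~ A j -> ds_comp f j = 0.
Proof. by move/negP; rewrite /ds_comp; destruct idP. Qed.

Lemma ds_comp_finfun A (F : forall j, V j) j :
  ds_comp ([ffun i => F (val i)] : dsum A) j = if A j then F j else 0.
Proof.
by rewrite /ds_comp; destruct idP; rewrite ?ffunE.
Qed.

Lemma ds_comp_is_linear A j : linear (fun f : dsum A => ds_comp f j).
Proof.
move=> a f g; rewrite /ds_comp; destruct idP.
  by rewrite ds_linE.
by rewrite scaler0 addr0.
Qed.

Lemma ds_ext A (f g : dsum A) : (forall j, ds_comp f j = ds_comp g j) -> f = g.
Proof. by move=> fg; apply/ffunP => i; rewrite -!ds_comp_val. Qed.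

(* Keep the components with index in B, and fill in zeros: this is the
   projection onto a partial sum when B is contained in A, and the embedding of
   a partial sum when A is contained in B. *)
Definition ds_res (A B : pred T) (f : dsum A) : dsum B :=
  [ffun i => ds_comp f (val i)].

Lemma ds_comp_res A B (f : dsum A) j :
  ds_comp (ds_res B f) j = if B j then ds_comp f j else 0.
Proof. exact: ds_comp_finfun. Qed.

Lemma ds_res_is_linear A B : linear (@ds_res A B).
Proof.
by move=> a f g; apply/ffunP => i; rewrite ds_linE !ffunE ds_comp_is_linear.
Qed.
HB.instance Definition _ A B :=
  GRing.isLinear.Build k (dsum A) (dsum B) _ (@ds_res A B)
    (@ds_res_is_linear A B).

Lemma ds_res_id A : @ds_res A A =1 id.
Proof. by move=> f; apply/ffunP => i; rewrite ffunE ds_comp_val. Qed.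

Lemma ds_res_res (A B C : pred T) (f : dsum A) :
  (forall j, A j -> C j -> B j) -> ds_res C (ds_res B f) = ds_res C f.
Proof.
move=> h; apply: ds_ext => j; rewrite !ds_comp_res.
case: ifP => // Cj; case: ifP => // Bj; rewrite ds_comp_out //.
by apply/negP => Aj; rewrite h in Bj.
Qed.

End DirectSum.

(* Finite-dimensional left modules over k['S_m], for the usual product of
   permutations: since (s * t)%g is "s, then t" in MathComp, the product
   t o s is written (s * t)%g. *)
Section Rep.
Variables (k : fieldType) (m : nat).

Record rep := Rep {
  rep_space :> vectType k;
  ract : 'S_m -> 'End(rep_space);
  ract1 : ract 1%g = \1%VF;
  ractM : forall s t : 'S_m, ract (s * t)%g = (ract t \o ract s)%VF }.
Arguments ract : clear implicits.

Record rhom (V W : rep) := RHom {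
  rhom_fun :> 'Hom(V, W);
  rhomP : forall s : 'S_m, (rhom_fun \o ract V s = ract W s \o rhom_fun)%VF }.

Lemma rhom_eq (V W : rep) (f : rhom V W) s v :
  f (ract V s v) = ract W s (f v).
Proof. by rewrite -!comp_lfunE rhomP. Qed.

Section Sub.
Variables (V : rep) (U : {vspace V}).
Hypothesis stableU : forall s u, u \in U -> ract V s u \in U.

Definition sub_act_fun s (u : subvs_of U) : subvs_of U :=
  vsproj U (ract V s (vsval u)).

Lemma sub_act_linear s : linear (sub_act_fun s).
Proof. by move=> a u v; rewrite /sub_act_fun !linearP. Qed.
HB.instance Definition _ s :=
  GRing.isLinear.Build k _ _ _ (sub_act_fun s) (sub_act_linear s).

Lemma sub_act_val s u : vsval (sub_act_fun s u) = ract V s (vsval u).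
Proof. by rewrite /sub_act_fun vsprojK // stableU // subvsP. Qed.

Fact sub_act1 : linfun (sub_act_fun 1%g) = \1%VF.
Proof.
by apply/lfunP => u; apply: val_inj; rewrite !lfunE /= sub_act_val ract1 lfunE.
Qed.
Fact sub_actM s t :
  linfun (sub_act_fun (s * t)%g)
    = (linfun (sub_act_fun t) \o linfun (sub_act_fun s))%VF.
Proof.
apply/lfunP => u; apply: val_inj.
by rewrite comp_lfunE !lfunE /= !sub_act_val ractM comp_lfunE.
Qed.
Definition subrep := Rep sub_act1 sub_actM.
End Sub.

Section Sum.
Variables (T : finType) (V : T -> rep) (A : pred T).

Definition sum_act_fun s (f : dsum V A) : dsum V A :=
  [ffun i => ract (V (val i)) s (f i)].

Lemma sum_act_linear s : linear (sum_act_fun s).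
Proof.
by move=> a u v; apply/ffunP => i; rewrite ds_linE !ffunE linearP.
Qed.
HB.instance Definition _ s :=
  GRing.isLinear.Build k _ _ _ (sum_act_fun s) (sum_act_linear s).

Fact sum_act1 : linfun (sum_act_fun 1%g) = \1%VF.
Proof.
by apply/lfunP => u; apply/ffunP => i; rewrite !lfunE /= ffunE ract1 lfunE.
Qed.
Fact sum_actM s t :
  linfun (sum_act_fun (s * t)%g)
    = (linfun (sum_act_fun t) \o linfun (sum_act_fun s))%VF.
Proof.
apply/lfunP => u; apply/ffunP => i.
by rewrite comp_lfunE !lfunE /= !ffunE ractM comp_lfunE.
Qed.
Definition sumrep := Rep sum_act1 sum_actM.

Lemma sum_act_comp s f j :
  ds_comp (ract sumrep s f) j = ract (V j) s (ds_comp f j).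
Proof.
rewrite /= lfunE /= /ds_comp; destruct idP; first by rewrite ffunE.
by rewrite linear0.
Qed.
End Sum.

Fact sum_resP (T : finType) (V : T -> rep) (A B : pred T) s :
  let r := linfun (@ds_res k T V A B) : 'Hom(sumrep V A, sumrep V B) in
  (r \o ract (sumrep V A) s = ract (sumrep V B) s \o r)%VF.
Proof.
move=> r; apply/lfunP => f; rewrite !comp_lfunE; apply: ds_ext => j.
rewrite sum_act_comp !lfunE /= !ds_comp_res.
have := sum_act_comp s f j; rewrite /= lfunE /= => ->.
by case: ifP => // _; rewrite linear0.
Qed.
Definition sum_res T V A B : rhom (sumrep V A) (sumrep V B) :=
  RHom (@sum_resP T V A B).

(* The tensor product of finite-dimensional spaces, as linear maps from the
   dual of M to V; the pure tensor of u and v is phi |-> phi u *: v. *)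
Section Tensor.

Definition tspace (M V : vectType k) : vectType k := 'Hom('Hom(M, k^o), V).

Definition tpure_fun (M V : vectType k) (u : M) (v : V) (phi : 'Hom(M, k^o)) :
  V := (phi u : k) *: v.
Lemma tpure_linear M V u v : linear (@tpure_fun M V u v).
Proof.
by move=> a p q; rewrite /tpure_fun add_lfunE scale_lfunE scalerDl scalerA.
Qed.
HB.instance Definition _ M V u v :=
  GRing.isLinear.Build k _ _ _ (@tpure_fun M V u v) (tpure_linear u v).
Definition tpure M V u v : tspace M V := linfun (@tpure_fun M V u v).

Definition dual_fun (M N : vectType k) (f : 'Hom(M, N)) (phi : 'Hom(N, k^o)) :
  'Hom(M, k^o) := (phi \o f)%VF.
Lemma dual_linear M N f : linear (@dual_fun M N f).
Proof. by move=> a p q; rewrite /dual_fun comp_lfunDl comp_lfunZl. Qed.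
HB.instance Definition _ M N f :=
  GRing.isLinear.Build k _ _ _ (@dual_fun M N f) (dual_linear f).

Definition tmap_fun (M N V W : vectType k) (f : 'Hom(M, N)) (h : 'Hom(V, W))
  (t : tspace M V) : tspace N W := (h \o (t \o linfun (dual_fun f)))%VF.
Lemma tmap_linear M N V W f h : linear (@tmap_fun M N V W f h).
Proof.
move=> a p q; rewrite /tmap_fun comp_lfunDl comp_lfunDr.
by rewrite comp_lfunZr comp_lfunZl.
Qed.
HB.instance Definition _ M N V W f h :=
  GRing.isLinear.Build k _ _ _ (@tmap_fun M N V W f h) (tmap_linear f h).
Definition tmap M N V W f h : 'Hom(tspace M V, tspace N W) :=
  linfun (@tmap_fun M N V W f h).

Lemma tmapE (M N V W : vectType k) (f : 'Hom(M, N)) (h : 'Hom(V, W)) t phi :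
  tmap f h t phi = h (t (phi \o f)%VF).
Proof. by rewrite lfunE /= /tmap_fun !comp_lfunE lfunE. Qed.

Lemma tmap_pure (M N V W : vectType k) (f : 'Hom(M, N)) (h : 'Hom(V, W)) u v :
  tmap f h (tpure u v) = tpure (f u) (h v).
Proof.
apply/lfunP => phi.
by rewrite tmapE !lfunE /= /tpure_fun comp_lfunE linearZ.
Qed.

Lemma tmap1 (M V : vectType k) : tmap (\1 : 'End(M)) (\1 : 'End(V)) = \1%VF.
Proof.
by apply/lfunP => t; apply/lfunP => phi; rewrite tmapE comp_lfun1r !lfunE.
Qed.

Lemma tmapM (M N P V W X : vectType k) (f : 'Hom(M, N)) (g : 'Hom(N, P))
  (h : 'Hom(V, W)) (l : 'Hom(W, X)) :
  tmap (g \o f)%VF (l \o h)%VF = (tmap g l \o tmap f h)%VF.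
Proof.
apply/lfunP => t; apply/lfunP => phi.
by rewrite comp_lfunE !tmapE comp_lfunE comp_lfunA.
Qed.

Section Objects.
Variables M V : rep.
Fact tens_act1 : tmap (ract M 1%g) (ract V 1%g) = \1%VF.
Proof. by rewrite !ract1 tmap1. Qed.
Fact tens_actM s t :
  tmap (ract M (s * t)%g) (ract V (s * t)%g)
    = (tmap (ract M t) (ract V t) \o tmap (ract M s) (ract V s))%VF.
Proof. by rewrite !ractM tmapM. Qed.
Definition tens : rep := @Rep (tspace M V) _ tens_act1 tens_actM.
End Objects.

Fact tens_idP (M V W : rep) (h : rhom V W) s :
  let f := tmap \1 h : 'Hom(tens M V, tens M W) in
  (f \o ract (tens M V) s = ract (tens M W) s \o f)%VF.
Proof. by rewrite /= -!tmapM rhomP comp_lfun1l comp_lfun1r. Qed.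
Definition tens_id M V W h : rhom (tens M V) (tens M W) :=
  RHom (@tens_idP M V W h).

End Tensor.

Section Sign.
Definition sgn_act (s : 'S_m) : 'End(k^o) := (-1) ^+ s *: \1%VF.
Fact sgn_act1 : sgn_act 1%g = \1%VF.
Proof. by rewrite /sgn_act odd_perm1 expr0 scale1r. Qed.
Fact sgn_actM s t : sgn_act (s * t)%g = (sgn_act t \o sgn_act s)%VF.
Proof.
rewrite /sgn_act odd_permM signr_addb -comp_lfunZl -comp_lfunZr comp_lfun1l.
by rewrite scalerA mulrC.
Qed.
Definition sgnrep : rep := Rep sgn_act1 sgn_actM.
End Sign.

(* An element x of the group algebra is the function with values its
   coefficients; (s * t^-1)%g is the composition t^-1 o s. *)
Section GroupAlgebra.

Definition galg : vectType k := {ffun 'S_m -> k^o}.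

Definition gelt (s : 'S_m) : galg := [ffun t => (t == s)%:R].
Definition gmul (x y : galg) : galg :=
  [ffun s => \sum_t x t * y (s * t^-1)%g].

Lemma gmul_gelt s t : gmul (gelt t) (gelt s) = gelt (s * t)%g.
Proof.
apply/ffunP => u; rewrite !ffunE (bigD1 t) //= big1 => [|v /negPf vt].
  by rewrite !ffunE eqxx mul1r addr0 -(inj_eq (mulIg t)) mulgKV.
by rewrite ffunE vt mul0r.
Qed.

Lemma gmulA x y z : gmul x (gmul y z) = gmul (gmul x y) z.
Proof.
apply/ffunP => s; rewrite !ffunE.
under eq_bigr => t _ do rewrite ffunE mulr_sumr.
rewrite exchange_big /=.
under [RHS]eq_bigr => t _ do rewrite ffunE mulr_suml.
rewrite [RHS]exchange_big [LHS]exchange_big /=; apply: eq_bigr => t _.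
rewrite (reindex_inj (mulIg t^-1%g)) /=; apply: eq_bigr => u _.
by rewrite mulrA invMg invgK -!mulgA [(t^-1 * _)%g]mulgA mulVg mul1g.
Qed.

Lemma gmul1l x : gmul (gelt 1%g) x = x.
Proof.
apply/ffunP => s; rewrite ffunE (bigD1 1%g) //= big1 => [|v /negPf v1].
  by rewrite ffunE eqxx mul1r invg1 mulg1 addr0.
by rewrite ffunE v1 mul0r.
Qed.

Lemma gmul_linear_r x : linear (gmul x).
Proof.
move=> a y z; apply/ffunP => s; rewrite !ffunE scaler_sumr -big_split /=.
by apply: eq_bigr => t _; rewrite !ffunE mulrDr; congr (_ + _); rewrite mulrCA.
Qed.
HB.instance Definition _ x :=
  GRing.isLinear.Build k galg galg _ (gmul x) (gmul_linear_r x).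

Definition rgmul (c x : galg) := gmul x c.
Lemma gmul_linear_l c : linear (rgmul c).
Proof.
move=> a y z; apply/ffunP => s; rewrite !ffunE scaler_sumr -big_split /=.
by apply: eq_bigr => t _; rewrite !ffunE mulrDl; congr (_ + _); rewrite -scalerAl.
Qed.
HB.instance Definition _ c :=
  GRing.isLinear.Build k galg galg _ (rgmul c) (gmul_linear_l c).

Fact reg_act1 : linfun (gmul (gelt 1%g)) = \1%VF.
Proof. by apply/lfunP => x; rewrite !lfunE /= gmul1l. Qed.
Fact reg_actM s t :
  linfun (gmul (gelt (s * t)%g))
    = (linfun (gmul (gelt t)) \o linfun (gmul (gelt s)))%VF.
Proof.
by apply/lfunP => x; rewrite comp_lfunE !lfunE /= gmulA gmul_gelt.
Qed.
Definition regrep : rep := Rep reg_act1 reg_actM.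

Definition lideal (c : galg) : {vspace galg} := limg (linfun (rgmul c)).

Fact lideal_stable c s x : x \in lideal c -> ract regrep s x \in lideal c.
Proof.
case/memv_imgP => y _ ->; apply/memv_imgP; exists (ract regrep s y).
  exact: memvf.
by rewrite /= !lfunE /= /rgmul gmulA.
Qed.
Definition lideal_rep (c : galg) : rep := @subrep regrep (lideal c) (@lideal_stable c).

End GroupAlgebra.

End Rep.

Arguments ract {k m} r s.

(* The index i : 'I_n stands for i + 1, and acts by exchanging i and i + 1 in
   'I_n.+1 = {0, ..., n}. *)
Section Ribbon.
Variables (k : fieldType) (n : nat).
Implicit Types I : {set 'I_n}.

Definition simple_refl (i : 'I_n) : 'S_n.+1 :=
  tperm (widen_ord (leqnSn n) i) (lift ord0 i).

Definition parabolic I : {set 'S_n.+1} := <<[set simple_refl i | i in I]>>%g.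

Definition a_elt I : galg k n.+1 := \sum_(w in parabolic I) gelt k w.
Definition b_elt I : galg k n.+1 :=
  \sum_(w in parabolic I) ((-1) ^+ w : k) *: (gelt k w : galg k n.+1).

Definition ribbon I : rep k n.+1 := lideal_rep (gmul (b_elt I) (a_elt (~: I))).

End Ribbon.

(* The cell C_(I, eps) is encoded by the map which is None on I, and Some of
   the sign eps j at j outside of I, with true standing for 1. *)
Section Cells.
Variable n : nat.

Definition cell := {ffun 'I_n -> option bool}.
Implicit Types C D : cell.

Definition zeros C : {set 'I_n} := [set i | C i == None].

Definition cell_le C D : bool :=
  (zeros D \subset zeros C) && [forall j in ~: zeros C, C j == D j].

Lemma cell_le_refl C : cell_le C C.
Proof. by rewrite /cell_le subxx; apply/forall_inP. Qed.

Lemma cell_le_trans D C E : cell_le C D -> cell_le D E -> cell_le C E.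
Proof.
case/andP=> sDC /forall_inP CD /andP[sED /forall_inP DE].
apply/andP; split; first exact: subset_trans sED sDC.
apply/forall_inP => j jC; rewrite (eqP (CD j jC)); apply: DE.
by have := jC; rewrite !inE (eqP (CD j jC)).
Qed.

Definition pos_cell (I : {set 'I_n}) : cell :=
  [ffun i => if i \in I then None else Some true].

Lemma zeros_pos_cell I : zeros (pos_cell I) = I.
Proof. by apply/setP => i; rewrite !inE ffunE; case: ifP. Qed.

Lemma pos_cell_le (I J : {set 'I_n}) :
  J \subset I -> cell_le (pos_cell I) (pos_cell J).
Proof.
move=> sJI; apply/andP; split; first by rewrite !zeros_pos_cell.
apply/forall_inP => j; rewrite zeros_pos_cell inE => jI; rewrite !ffunE.
by rewrite (negPf jI) (negPf (contra (subsetP sJI j) jI)).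
Qed.

End Cells.

Section Bisheaves.
Variables (k : fieldType) (m n : nat).
Local Notation rep := (rep k m).
Local Notation cell := (cell n).

Record bisheaf := Bisheaf {
  stalk :> cell -> rep;
  gam : forall C D, cell_le C D -> rhom (stalk C) (stalk D);
  del : forall C D, cell_le C D -> rhom (stalk D) (stalk C);
  gam_id : forall C (h : cell_le C C), gam h = \1%VF :> 'Hom(_, _);
  gam_comp : forall C D E (h1 : cell_le C D) (h2 : cell_le D E)
    (h : cell_le C E), gam h = (gam h2 \o gam h1)%VF :> 'Hom(_, _);
  del_id : forall C (h : cell_le C C), del h = \1%VF :> 'Hom(_, _);
  del_comp : forall C D E (h1 : cell_le C D) (h2 : cell_le D E)
    (h : cell_le C E), del h = (del h1 \o del h2)%VF :> 'Hom(_, _) }.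
Arguments gam : clear implicits.
Arguments del : clear implicits.

Record bhom (E F : bisheaf) := BHom {
  bhom_at :> forall C, rhom (E C) (F C);
  bhom_gam : forall C D (h : cell_le C D),
    (bhom_at D \o gam E C D h = gam F C D h \o bhom_at C)%VF;
  bhom_del : forall C D (h : cell_le C D),
    (bhom_at C \o del E C D h = del F C D h \o bhom_at D)%VF }.

Definition biso (E F : bisheaf) : Prop :=
  exists (f : bhom E F) (g : bhom F E), forall C,
    (g C \o f C = \1)%VF /\ (f C \o g C = \1)%VF.

Lemma biso_refl E : biso E E.
Proof.
have idP C s : (\1 \o ract (E C) s = ract (E C) s \o \1)%VF.
  by rewrite comp_lfun1l comp_lfun1r.
pose f C := RHom (idP C).
have f_gam C D (h : cell_le C D) : (f D \o gam E C D h = gam E C D h \o f C)%VF.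
  by rewrite comp_lfun1l comp_lfun1r.
have f_del C D (h : cell_le C D) : (f C \o del E C D h = del E C D h \o f D)%VF.
  by rewrite comp_lfun1l comp_lfun1r.
by exists (BHom f_gam f_del), (BHom f_gam f_del) => C; rewrite comp_lfun1l.
Qed.

(* Amonodromic semisimple families: there are no maps between the Phi I. *)
Definition ggm := {set 'I_n} -> rep.

Definition fs_ggm (Phi : ggm) : ggm := fun I => Phi (~: I).

Section Q.
Variable Phi : ggm.

Definition q_stalk (C : cell) : rep :=
  sumrep Phi (fun J => J \subset zeros C).
Definition q_res (C D : cell) : rhom (q_stalk C) (q_stalk D) :=
  sum_res Phi _ _.

Fact q_id C : q_res C C = \1%VF :> 'Hom(_, _).
Proof. by apply/lfunP => f; rewrite !lfunE /= ds_res_id. Qed.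

Fact q_gam_comp C D E : cell_le C D -> cell_le D E ->
  q_res C E = (q_res D E \o q_res C D)%VF :> 'Hom(_, _).
Proof.
case/andP=> sDC _ /andP[sED _].
apply/lfunP => f; rewrite comp_lfunE !lfunE /= ds_res_res // => J _ sJE.
exact: subset_trans sJE sED.
Qed.

Fact q_del_comp C D E : cell_le C D -> cell_le D E ->
  q_res E C = (q_res D C \o q_res E D)%VF :> 'Hom(_, _).
Proof.
case/andP=> sDC _ /andP[sED _].
apply/lfunP => f; rewrite comp_lfunE !lfunE /= ds_res_res // => J sJE _.
exact: subset_trans sJE sED.
Qed.

(* When C <= D, q_res C D is a projection, and q_res D C an embedding. *)
Definition qsheaf : bisheaf :=
  @Bisheaf q_stalk (fun C D _ => q_res C D) (fun C D _ => q_res D C)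
    (fun C _ => q_id C) (fun C D E h1 h2 _ => q_gam_comp h1 h2)
    (fun C _ => q_id C) (fun C D E h1 h2 _ => q_del_comp h1 h2).
End Q.

(* pggm E I is the intersection of the kernels of the maps gamma from the
   positive cell of I to those of the proper subsets J of I; for I empty this
   is the whole stalk. *)
Section P.
Variables (E : bisheaf) (I : {set 'I_n}).

Definition p_space : {vspace E (pos_cell I)} :=
  (\bigcap_(J : {J : {set 'I_n} | J \proper I})
     lker (gam E _ _ (pos_cell_le (proper_sub (valP J)))))%VS.

Fact p_stable s u : u \in p_space -> ract (E (pos_cell I)) s u \in p_space.
Proof.
rewrite /p_space => /subv_bigcapP uP; apply/subv_bigcapP => J _.
have := uP J isT; rewrite -!memvE !memv_ker => /eqP uJ.
by rewrite rhom_eq uJ linear0.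
Qed.
End P.

Definition pggm (E : bisheaf) : ggm := fun I => subrep (@p_stable E I).

Record hyp_ass := HypAss {
  hyp_sheaf :> bisheaf;
  hyp_assP : exists Phi, biso (qsheaf Phi) hyp_sheaf }.

Definition hyp_iso (E F : hyp_ass) : Prop := biso E F.

Definition qhyp (Phi : ggm) : hyp_ass :=
  @HypAss (qsheaf Phi) (ex_intro _ Phi (biso_refl _)).

(* On objects: fs_ggm transported along the equivalence qhyp and its
   quasi-inverse pggm. *)
Definition fourier_sato (E : hyp_ass) : hyp_ass := qhyp (fs_ggm (pggm E)).

Section TensorSheaf.
Variables (M : rep) (E : bisheaf).

Lemma tens_id1 (V : rep) (h : rhom V V) :
  h = \1%VF :> 'Hom(_, _) -> tens_id M h = \1%VF :> 'Hom(_, _).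
Proof. by move=> /= ->; rewrite tmap1. Qed.

Lemma tens_idM (V W X : rep) (f : rhom V W) (g : rhom W X) (h : rhom V X) :
  h = (g \o f)%VF :> 'Hom(_, _) ->
  tens_id M h = (tens_id M g \o tens_id M f)%VF :> 'Hom(_, _).
Proof. by move=> /= ->; rewrite -tmapM comp_lfun1l. Qed.

Definition tens_sheaf : bisheaf :=
  @Bisheaf (fun C => tens M (E C))
    (fun C D h => tens_id M (gam E C D h))
    (fun C D h => tens_id M (del E C D h))
    (fun C h => tens_id1 (gam_id E h))
    (fun C D X h1 h2 h => tens_idM (gam_comp E h1 h2 h))
    (fun C h => tens_id1 (del_id E h))
    (fun C D X h1 h2 h => tens_idM (del_comp E h1 h2 h)).
End TensorSheaf.

Section TensorQ.
Variables (M : rep) (Phi : ggm).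

Let tPhi : ggm := fun I => tens M (Phi I).

Definition dist_to (A : pred {set 'I_n})
  (t : dsum tPhi A) (phi : 'Hom(M, k^o)) : dsum Phi A :=
  [ffun i => (t i : 'Hom('Hom(M, k^o), Phi (val i))) phi].
Lemma dist_to_linear A t : linear (@dist_to A t).
Proof. by move=> a p q; apply/ffunP => i; rewrite ds_linE !ffunE linearP. Qed.
HB.instance Definition _ A t :=
  GRing.isLinear.Build k _ _ _ (@dist_to A t) (dist_to_linear t).

Definition dist (A : pred {set 'I_n}) (t : sumrep tPhi A) :
  tens M (sumrep Phi A) := linfun (dist_to t).

Lemma dist_comp A (t : sumrep tPhi A) phi j :
  ds_comp (dist t phi) j = (ds_comp t j : 'Hom('Hom(M, k^o), Phi j)) phi.
Proof.
rewrite lfunE /= /ds_comp; destruct idP; first by rewrite ffunE.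
by rewrite lfunE.
Qed.

Lemma dist_linear A : linear (@dist A).
Proof.
move=> a p q; apply/lfunP => phi; apply: ds_ext => j.
rewrite add_lfunE scale_lfunE ds_comp_is_linear !dist_comp ds_comp_is_linear.
by rewrite add_lfunE scale_lfunE.
Qed.
HB.instance Definition _ A :=
  GRing.isLinear.Build k _ _ _ (@dist A) (@dist_linear A).

Definition codist_at (A : pred {set 'I_n})
  (t : tens M (sumrep Phi A)) (j : {set 'I_n}) (phi : 'Hom(M, k^o)) : Phi j :=
  ds_comp (t phi) j.
Lemma codist_at_linear A t j : linear (@codist_at A t j).
Proof. by move=> a p q; rewrite /codist_at linearP ds_comp_is_linear. Qed.
HB.instance Definition _ A t j :=
  GRing.isLinear.Build k _ _ _ (@codist_at A t j) (codist_at_linear t j).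

Definition codist (A : pred {set 'I_n}) (t : tens M (sumrep Phi A)) :
  sumrep tPhi A := [ffun i => linfun (codist_at t (val i)) : tPhi (val i)].

Lemma codist_comp A (t : tens M (sumrep Phi A)) j phi :
  (ds_comp (codist t) j : 'Hom('Hom(M, k^o), Phi j)) phi = ds_comp (t phi) j.
Proof.
rewrite {1}/ds_comp; destruct idP as [Aj|nAj]; first by rewrite ffunE lfunE.
by rewrite lfunE ds_comp_out //; apply/negP.
Qed.

Lemma codist_linear A : linear (@codist A).
Proof.
move=> a p q; apply: ds_ext => j; apply/lfunP => phi.
rewrite codist_comp ds_comp_is_linear !add_lfunE !scale_lfunE.
by rewrite ds_comp_is_linear !codist_comp.
Qed.
HB.instance Definition _ A :=
  GRing.isLinear.Build k _ _ _ (@codist A) (@codist_linear A).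

Lemma distK A : cancel (@dist A) (@codist A).
Proof.
move=> t; apply: ds_ext => j; apply/lfunP => phi.
by rewrite codist_comp dist_comp.
Qed.
Lemma codistK A : cancel (@codist A) (@dist A).
Proof.
move=> t; apply/lfunP => phi; apply: ds_ext => j.
by rewrite dist_comp codist_comp.
Qed.

Lemma dist_act A s t :
  dist (ract (sumrep tPhi A) s t) = ract (tens M (sumrep Phi A)) s (dist t).
Proof.
apply/lfunP => phi; apply: ds_ext => j.
by rewrite dist_comp sum_act_comp !tmapE sum_act_comp dist_comp.
Qed.

Lemma dist_res A B t : dist (ds_res B t) = tens_id M (sum_res Phi A B) (dist t).
Proof.
apply/lfunP => phi; apply: ds_ext => j.
rewrite dist_comp tmapE comp_lfun1r lfunE /= !ds_comp_res dist_comp.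
by case: ifP => // _; rewrite lfunE.
Qed.

Fact distP A s :
  let f := linfun (@dist A) : 'Hom(sumrep tPhi A, tens M (sumrep Phi A)) in
  (f \o ract (sumrep tPhi A) s = ract (tens M (sumrep Phi A)) s \o f)%VF.
Proof.
by move=> f; apply/lfunP => t; rewrite !comp_lfunE ![f _]lfunE; apply: dist_act.
Qed.
Fact codistP A s :
  let f := linfun (@codist A) : 'Hom(tens M (sumrep Phi A), sumrep tPhi A) in
  (f \o ract (tens M (sumrep Phi A)) s = ract (sumrep tPhi A) s \o f)%VF.
Proof.
move=> f; apply/lfunP => t; rewrite !comp_lfunE ![f _]lfunE.
by apply: (can_inj (@distK A)); rewrite [LHS]codistK dist_act [dist _]codistK.
Qed.

Fact tens_qsheaf : biso (qsheaf tPhi) (tens_sheaf M (qsheaf Phi)).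
Proof.
pose E := qsheaf tPhi; pose F := tens_sheaf M (qsheaf Phi).
pose A C := fun J : {set 'I_n} => J \subset zeros C.
pose f C : rhom (E C) (F C) := RHom (@distP (A C)).
pose g C : rhom (F C) (E C) := RHom (@codistP (A C)).
have fE C t : f C t = dist t by rewrite lfunE.
have gE C t : g C t = codist t by rewrite lfunE.
pose r C D : rhom (E C) (E D) := sum_res tPhi (A C) (A D).
pose r' C D : rhom (F C) (F D) := tens_id M (sum_res Phi (A C) (A D)).
have fr C D : (f D \o r C D = r' C D \o f C)%VF.
  by apply/lfunP => t; rewrite !comp_lfunE !fE -dist_res lfunE.
have gr C D : (g D \o r' C D = r C D \o g C)%VF.
  apply/lfunP => t; rewrite !comp_lfunE !gE.
  apply: (can_inj (@distK (A D))).
  by rewrite [LHS]codistK [r C D _]lfunE [RHS]dist_res [dist _]codistK.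
exists (@BHom E F f (fun C D _ => fr C D) (fun C D _ => fr D C)).
exists (@BHom F E g (fun C D _ => gr C D) (fun C D _ => gr D C)).
move=> C; split; apply/lfunP => t; rewrite comp_lfunE.
  by rewrite fE gE lfunE; apply: distK.
by rewrite gE fE lfunE; apply: codistK.
Qed.

(* M (x) Q(Phi), as an object of the subcategory: it is isomorphic to
   Q(M (x) Phi). *)
Definition tens_hyp : hyp_ass :=
  @HypAss (tens_sheaf M (qsheaf Phi))
    (ex_intro (fun Psi => biso (qsheaf Psi) _) tPhi tens_qsheaf).
End TensorQ.

End Bisheaves.

(* Q_M: the stalks are M (x) (sum of the R_J, J contained in I). *)
Definition ribbon_sheaf (k : fieldType) (n : nat) (M : rep k n.+1) :
  hyp_ass k n.+1 n :=
  tens_hyp M (@ribbon k n).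

(* Main.v *)
(* FT and P, Q only permute summands, so everything reduces to
   M (x) R_(~I) ~ (M (x) sgn) (x) R_I, hence to a sign-twisted isomorphism
   between R_(~I) = k[S] b_(~I) a_I and R_I = k[S] b_I a_(~I). The automorphism
   w |-> sgn(w) w of k[S] exchanges a_J and b_J, so it carries R_(~I) to
   k[S] a_(~I) b_I, and right multiplication by a_(~I) then lands in R_I. Right
   multiplications by a = a_(~I) and b = b_I have symmetric matrices A, B, and
   A B A is, up to a scalar, the Gram matrix (A B) (A B)^T; over the rationals,
   hence over any field of characteristic 0, it has the same kernel as A B, so
   the twisted map is injective. The same map in the other direction shows that
   the dimensions agree. *)
From HB Require Import structures.
Require Import Defs.
From mathcomp Require Import all_boot all_order all_fingroup all_algebra.
(* Restores Defs.ract, which the ract of fingroup.action shadows. *)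
Import Defs.

Set Implicit Arguments.
Unset Strict Implicit.
Unset Printing Implicit Defensive.

Import GRing.Theory Num.Theory.
Local Open Scope ring_scope.

(** * Gram matrices over ordered fields and in characteristic 0 *)

(** If u X^T X = 0, then u X^T has norm 0, hence vanishes, since a sum of squares is positive. So
    X^T X has the rank of X, and its row space, which lies in that of X, fills it. *)
Lemma gram_row_space (F : realFieldType) m n (X : 'M[F]_(m, n)) :
  (X <= X^T *m X)%MS.
Proof.
have norm0 (v : 'rV[F]_m) : v *m v^T = 0 -> v = 0.
  move/matrixP/(_ 0 0); rewrite !mxE; under eq_bigr do rewrite mxE -expr2.
  move/eqP; rewrite psumr_eq0 => [/allP v0|j _]; last exact: sqr_ge0.
  apply/rowP => j; apply/eqP; rewrite mxE -sqrf_eq0.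
  exact: v0 (mem_index_enum j).
have kerX : (kermx (X^T *m X) <= kermx X^T)%MS.
  apply/row_subP => i; rewrite sub_kermx; set u := row i _.
  have uXX : u *m X^T *m X = 0.
    by apply/eqP; rewrite -mulmxA -sub_kermx row_sub.
  by apply/eqP/norm0; rewrite trmx_mul trmxK mulmxA uXX mul0mx.
rewrite -(geq_leqif (mxrank_leqif_sup (submxMl X^T X))).
have := mxrankS kerX; rewrite !mxrank_ker mxrank_tr.
by rewrite leq_sub2lE // rank_leq_col.
Qed.

(* MathComp makes ratr a morphism only for numFieldType. *)
Section RationalsInCharZero.
Variables (k : fieldType) (char0 : [pchar k] =i pred0).

Lemma intr_eq0_char0 (d : int) : (d%:~R == 0 :> k) = (d == 0).
Proof.
have nat0 := (pcharf0P k).1 char0.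
by case: d => d; rewrite ?NegzE ?rmorphN ?oppr_eq0 /= -pmulrn nat0.
Qed.

(** [ratr] is defined by the reduced fraction; its value on an arbitrary one lets the morphism laws
    be checked by the usual formulas for sums and products of fractions. *)
Lemma ratr_frac_char0 (p q : int) :
  q != 0 -> ratr (p%:~R / q%:~R) = p%:~R / q%:~R :> k.
Proof.
move=> q0; rewrite /ratr; set x := _ / _.
apply/eqP; rewrite eqr_div ?intr_eq0_char0 ?denq_neq0 // -!rmorphM.
apply/eqP; congr _%:~R; apply: (@intr_inj rat).
by rewrite !rmorphM /= numqE /x mulrAC divfK ?intr_eq0.
Qed.

Fact ratr_char0_zmod_morphism : zmod_morphism (@ratr k).
Proof.
move=> x y; rewrite -[x]divq_num_den -[y]divq_num_den -mulNr -mulrNz.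
have dx := denq_neq0 x; have dy := denq_neq0 y.
rewrite addf_div ?intr_eq0 // -!intrM -intrD.
rewrite !ratr_frac_char0 ?mulf_neq0 // -mulNr -mulrNz.
by rewrite addf_div ?intr_eq0_char0 // -!intrM -intrD.
Qed.

Fact ratr_char0_monoid_morphism : monoid_morphism (@ratr k).
Proof.
split=> [|x y]; first by rewrite (ratr_nat _ 1).
rewrite -[x]divq_num_den -[y]divq_num_den.
have dx := denq_neq0 x; have dy := denq_neq0 y.
by rewrite mulf_div -!intrM !ratr_frac_char0 ?mulf_neq0 // mulf_div -!intrM.
Qed.

(** Positivity makes no sense in [k], but an integer matrix comes from [rat], and inclusions of row
    spaces survive the field morphism to [k]. *)
Lemma gram_row_space_char0 m n (X : 'M[int]_(m, n)) :
  (map_mx (intr : int -> k) X <= (map_mx intr X)^T *m map_mx intr X)%MS.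
Proof.
pose rZ := GRing.isZmodMorphism.Build rat k _ ratr_char0_zmod_morphism.
pose rM := GRing.isMonoidMorphism.Build rat k _ ratr_char0_monoid_morphism.
pose f : {rmorphism rat -> k} := HB.pack (@ratr k) rZ rM.
pose Z := map_mx (intr : int -> rat) X.
have -> : map_mx intr X = map_mx f Z.
  by apply/matrixP => i j; rewrite !mxE [RHS]ratr_int.
by rewrite map_trmx -map_mxM map_submx gram_row_space.
Qed.
End RationalsInCharZero.

(** * Symmetrizers, antisymmetrizers and their right multiplication matrices *)

Section SignedSums.
Variables (k : fieldType) (m : nat).
Local Notation galg := (galg k m).
Implicit Types (x y z : galg) (W : {group 'S_m}) (sg : bool).

(** Treats the symmetrizer ([sg] false) and the antisymmetrizer ([sg] true) uniformly. *)
Definition signed_sum sg (A : {set 'S_m}) : galg :=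
  [ffun w => if w \in A then (-1) ^+ (sg && odd_perm w) else 0].

Lemma signed_sum_sq sg W :
  gmul (signed_sum sg W) (signed_sum sg W) = #|W|%:R *: signed_sum sg W.
Proof.
apply/ffunP => s; rewrite !ffunE.
have -> : #|W|%:R = \sum_(t in W) 1 :> k by rewrite sumr_const.
rewrite scaler_suml [RHS]big_mkcond; apply: eq_bigr => t _; rewrite !ffunE.
case: ifP => tW; last by rewrite mul0r.
rewrite groupMr ?groupV //; case: ifP => sW; last by rewrite mulr0 scaler0.
rewrite scale1r; case: sg => /=; last by rewrite mulr1.
by rewrite odd_permM odd_permV signr_addb mulrCA -expr2 sqrr_sign mulr1.
Qed.

(** The matrix of right multiplication by [y] in the basis of permutations, acting on row vectors of
    coefficients. *)
Definition rmul_mx y : 'M[k]_#|'S_m| :=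
  \matrix_(i, j) y (enum_val j * (enum_val i)^-1)%g.
Definition coef_rv x : 'rV[k]_#|'S_m| := \row_i x (enum_val i).

Lemma coef_rv_inj : injective coef_rv.
Proof.
move=> x y /rowP xy; apply/ffunP => s.
by have := xy (enum_rank s); rewrite !mxE enum_rankK.
Qed.

Lemma coef_rv0 : coef_rv 0 = 0.
Proof. by apply/rowP => i; rewrite !mxE ffunE. Qed.

Lemma coef_rvM x y : coef_rv (gmul x y) = coef_rv x *m rmul_mx y.
Proof.
apply/rowP => j; rewrite !mxE ffunE (reindex (@enum_val _ 'S_m)) /=.
  by apply: eq_bigr => i _; rewrite !mxE.
exact/onW_bij/enum_val_bij.
Qed.

(** Transposition replaces each permutation by its inverse, which preserves both membership in [W]
    and the sign. *)
Lemma rmul_mx_signed_tr sg W :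
  (rmul_mx (signed_sum sg W))^T = rmul_mx (signed_sum sg W).
Proof.
apply/matrixP => i j; rewrite !mxE !ffunE -[X in X \in _]invgK groupV.
by rewrite invMg invgK !odd_permM !odd_permV addbC.
Qed.

Lemma rmul_mxM y z : rmul_mx (gmul y z) = rmul_mx y *m rmul_mx z.
Proof.
apply/row_matrixP => i; rewrite row_mul.
have rowE u : row i (rmul_mx u) = coef_rv (gmul (gelt k (enum_val i)) u).
  apply/rowP => j; rewrite !mxE ffunE (bigD1 (enum_val i)) //=.
  rewrite big1 => [|t /negPf tE].
    by rewrite ffunE eqxx mul1r addr0.
  by rewrite ffunE tE mul0r.
by rewrite !rowE gmulA coef_rvM.
Qed.

Lemma rmul_mxZ c y : rmul_mx (c *: y) = c *: rmul_mx y.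
Proof. by apply/matrixP => i j; rewrite !mxE ffunE. Qed.

Lemma signed_sum_cancel sg sg' W W' x : [pchar k] =i pred0 ->
  let a := signed_sum sg W in let b := signed_sum sg' W' in
  gmul (gmul (gmul x a) b) a = 0 -> gmul (gmul x a) b = 0.
Proof.
move=> char0 a b xaba; apply: coef_rv_inj.
(* The entries are 0, 1 or -1, so the matrices lift to the integers. *)
pose imx s (V : {group 'S_m}) : 'M[int]_#|'S_m| := \matrix_(i, j)
  let w := (enum_val j * (enum_val i)^-1)%g in
  if w \in V then (-1) ^+ (s && odd_perm w) else 0.
have imxE s V : map_mx intr (imx s V) = rmul_mx (signed_sum s V).
  apply/matrixP => i j; rewrite !mxE ffunE /=; case: ifP => // _.
  by rewrite rmorph_sign.
(* For X = B A, symmetry and B B = |W'| B turn X^T X into |W'| A B A. *)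
have := gram_row_space_char0 char0 (imx sg' W' *m imx sg W).
rewrite /= map_mxM !imxE -/a -/b trmx_mul !rmul_mx_signed_tr -!/a -!/b.
rewrite mulmxA -(mulmxA (rmul_mx a)) -(rmul_mxM b b).
rewrite [gmul b b]signed_sum_sq rmul_mxZ.
(* Transposing B A = D (|W'| A B A) gives A B = |W'| A B A D^T, so a row vector killed by A B A is
   killed by A B. *)
case/submxP => D /(congr1 trmx); rewrite !trmx_mul linearZ /=.
rewrite !rmul_mx_signed_tr -!/a -!/b => abE.
rewrite coef_rv0 !coef_rvM -mulmxA abE.
have := congr1 coef_rv xaba; rewrite !coef_rvM coef_rv0 => xaba0.
rewrite -scalemxAl -scalemxAr -scalemxAl -scalemxAr.
by rewrite !mulmxA xaba0 mul0mx scaler0.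
Qed.

End SignedSums.

(** * The sign automorphism and the twisted map between ribbon ideals *)

Section SignTwist.
Variables (k : fieldType) (m : nat).
Local Notation galg := (galg k m).
Implicit Types (x y z : galg).

Definition sgn_twist x : galg := [ffun w => (-1) ^+ odd_perm w * x w].

Lemma sgn_twist_linear : linear sgn_twist.
Proof. by move=> c x y; apply/ffunP => w; rewrite !ffunE mulrDr mulrCA. Qed.
HB.instance Definition _ :=
  GRing.isLinear.Build k galg galg _ sgn_twist sgn_twist_linear.

Lemma sgn_twistK : involutive sgn_twist.
Proof.
move=> x; apply/ffunP => w.
by rewrite !ffunE mulrA -expr2 sqrr_sign mul1r.
Qed.

Lemma sgn_twistM x y : sgn_twist (gmul x y) = gmul (sgn_twist x) (sgn_twist y).
Proof.
apply/ffunP => s; rewrite !ffunE mulr_sumr; apply: eq_bigr => t _.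
rewrite !ffunE mulrACA; congr (_ * _).
by rewrite odd_permM odd_permV signr_addb mulrCA -expr2 sqrr_sign mulr1.
Qed.

Lemma sgn_twist_gelt s : sgn_twist (gelt k s) = (-1) ^+ odd_perm s *: gelt k s.
Proof.
apply/ffunP => w; rewrite !ffunE; case: eqP => [->|_] //.
by rewrite !mulr0 scaler0.
Qed.

Lemma sgn_twist_signed_sum sg (A : {set 'S_m}) :
  sgn_twist (signed_sum k sg A) = signed_sum k (~~ sg) A.
Proof.
apply/ffunP => w; rewrite !ffunE; case: ifP => _; last by rewrite mulr0.
by case: sg; rewrite /= ?mulr1 // -expr2 sqrr_sign.
Qed.

End SignTwist.

Lemma gmulZl (k : fieldType) m c (x y : galg k m) :
  gmul (c *: x) y = c *: gmul x y.
Proof. exact: (linearZ_LR (rgmul y)). Qed.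

Lemma lideal_act_val (k : fieldType) m (c : galg k m) s (u : lideal_rep c) :
  vsval (ract (lideal_rep c) s u) = gmul (gelt k s) (vsval u).
Proof.
rewrite lfunE /=.
rewrite (@sub_act_val _ _ (regrep k m) _ (@lideal_stable k m c)).
by rewrite /= lfunE.
Qed.

(** This amounts to a module map from [V] to [W] tensored with the sign, without forming that tensor
    product. *)
Definition sgn_equivariant (k : fieldType) m (V W : rep k m) (f : 'Hom(V, W)) :=
  forall s v, f (ract V s v) = (-1) ^+ odd_perm s *: ract W s (f v).

Section TwistMap.
Variables (k : fieldType) (m : nat) (A B : {group 'S_m}).
Local Notation alt G := (signed_sum k true G).
Local Notation sym G := (signed_sum k false G).
Local Notation V := (lideal_rep (gmul (alt B) (sym A))).
Local Notation W := (lideal_rep (gmul (alt A) (sym B))).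

(** [vsproj] only gives the value its type: by [twist_map_val] the product already lies in the
    target ideal. *)
Definition twist_map_fun (u : V) : W :=
  vsproj _ (gmul (sgn_twist (vsval u)) (sym B)).

Lemma twist_map_linear : linear twist_map_fun.
Proof.
move=> c u v; rewrite /twist_map_fun !linearP /=.
have := gmul_linear_l (sym B) c (sgn_twist (vsval u)) (sgn_twist (vsval v)).
by rewrite /rgmul => ->; rewrite linearP.
Qed.
HB.instance Definition _ :=
  GRing.isLinear.Build k V W _ twist_map_fun twist_map_linear.

Lemma twist_map_val u :
  vsval (twist_map_fun u) = gmul (sgn_twist (vsval u)) (sym B).
Proof.
rewrite vsprojK //; have /memv_imgP[y _ ->] := subvsP u.
rewrite lfunE /= /rgmul !sgn_twistM !sgn_twist_signed_sum /= !gmulA.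
(* For u = y [alt B] [sym A], the twist followed by [sym B] is (twist of y) [sym B] [alt A] [sym B],
   a left multiple of the generator of [W]. *)
apply/memv_imgP; exists (gmul (sgn_twist y) (sym B)); first exact: memvf.
by rewrite lfunE /= /rgmul !gmulA.
Qed.

(** On u = y [alt B] [sym A] the value is (twist of y) [sym B] [alt A] [sym B]. If it vanishes,
    [signed_sum_cancel] removes the last factor, and what remains is the twist of u. *)
Lemma twist_map_inj : [pchar k] =i pred0 -> injective (linfun twist_map_fun).
Proof.
move=> char0; apply/lker0P; rewrite -subv0; apply/subvP => u.
rewrite memv_ker memv0 lfunE /= => /eqP/(congr1 vsval).
rewrite twist_map_val linear0 => u0.
apply/eqP/val_inj/(inv_inj (@sgn_twistK _ _)).
rewrite /= linear0; move: u0; have /memv_imgP[y _ ->] := subvsP u.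
rewrite lfunE /= /rgmul !sgn_twistM !sgn_twist_signed_sum /= !gmulA.
exact: signed_sum_cancel.
Qed.

Lemma twist_map_equivariant :
  sgn_equivariant (linfun twist_map_fun : 'Hom(V, W)).
Proof.
move=> s u; apply: val_inj; rewrite [LHS]/= lfunE linearZ /=.
rewrite [in RHS]lfunE !lideal_act_val !twist_map_val lideal_act_val.
by rewrite sgn_twistM sgn_twist_gelt !gmulZl gmulA.
Qed.

End TwistMap.

(** * Linear bijections and dimension counts *)

Section LinearBijections.
Variables (k : fieldType) (V W : vectType k).

Lemma bij_lfun_inv (f : 'Hom(V, W)) :
  bijective f -> exists2 g : 'Hom(W, V), cancel f g & cancel g f.
Proof.
move=> bijf; exists f^-1%VF.
  exact/lker0_lfunK/lker0P/bij_inj.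
case: bijf => g _ gK w; apply: limg_lfunVK.
by apply/memv_imgP; exists (g w); rewrite ?memvf ?gK.
Qed.

Lemma lfun_inj_dim_le (f : 'Hom(V, W)) : injective f -> (dim V <= dim W)%N.
Proof.
move/lker0P/eqP=> kerf; rewrite -!dimvf.
rewrite -(@limg_dim_eq _ _ _ f fullv) ?kerf ?capv0 //.
exact/dimvS/subvf.
Qed.

Lemma lfun_inj_bij (f : 'Hom(V, W)) :
  injective f -> (dim W <= dim V)%N -> bijective f.
Proof.
move=> injf leWV; have kerf := introT lker0P injf.
have limgf : limg f = fullv.
  apply/eqP; rewrite eqEdim subvf dimvf limg_dim_eq ?dimvf //.
  by rewrite (eqP kerf) capv0.
exists f^-1%VF; first exact: lker0_lfunK.
by move=> w; rewrite limg_lfunVK // limgf memvf.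
Qed.
End LinearBijections.

Lemma twist_map_bij (k : fieldType) m (A B : {group 'S_m}) :
  [pchar k] =i pred0 -> bijective (linfun (@twist_map_fun k m A B)).
Proof.
move=> char0; apply: lfun_inj_bij; first exact: twist_map_inj.
(* Exchanging [A] and [B] gives an injection from the target back to the source, hence the other
   inequality of dimensions. *)
exact: lfun_inj_dim_le (@twist_map_inj _ _ B A char0).
Qed.

(** * Isomorphisms of representations and restriction to subrepresentations *)

Section RepIsomorphisms.
Variables (k : fieldType) (m : nat).
Implicit Types V W X : rep k m.

Definition rep_iso V W :=
  exists (f : rhom V W) (g : rhom W V), cancel f g /\ cancel g f.

Lemma bij_rep_iso V W (f : rhom V W) : bijective f -> rep_iso V W.
Proof.
case/bij_lfun_inv=> g fK gK.
have gP s : (g \o ract W s = ract V s \o g)%VF.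
  by apply/lfunP => w; rewrite !comp_lfunE -{1}[w]gK -rhom_eq fK.
by exists f, (RHom gP).
Qed.

Lemma rep_iso_trans V W X : rep_iso V W -> rep_iso W X -> rep_iso V X.
Proof.
case=> f [f' [fK f'K]] [h [h' [hK h'K]]].
have hfP s : (h \o f \o ract V s = ract X s \o (h \o f))%VF.
  by rewrite -comp_lfunA rhomP !comp_lfunA rhomP.
apply: (bij_rep_iso (f := RHom hfP)).
apply: eq_bij (bij_comp (Bijective hK h'K) (Bijective fK f'K)) _ _.
by move=> v; rewrite /= comp_lfunE.
Qed.

Lemma subrep_act_val V (U : {vspace V})
  (stableU : forall s u, u \in U -> ract V s u \in U) s (u : subrep stableU) :
  vsval (ract (subrep stableU) s u) = ract V s (vsval u).
Proof. by rewrite lfunE /= sub_act_val. Qed.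

Section Subrep.
Variables (V W : rep k m) (f : rhom V W) (U : {vspace V}) (U' : {vspace W}).
Hypothesis stableU : forall s u, u \in U -> ract V s u \in U.
Hypothesis stableU' : forall s u, u \in U' -> ract W s u \in U'.
Hypothesis fU : forall u, u \in U -> f u \in U'.

Definition subrep_map_fun (u : subrep stableU) : subrep stableU' :=
  vsproj U' (f (vsval u)).
Lemma subrep_map_linear : linear subrep_map_fun.
Proof. by move=> c u v; rewrite /subrep_map_fun !linearP. Qed.
HB.instance Definition _ :=
  GRing.isLinear.Build k _ _ _ subrep_map_fun subrep_map_linear.

Lemma subrep_map_val u : vsval (linfun subrep_map_fun u) = f (vsval u).
Proof. by rewrite lfunE /= vsprojK // fU // subvsP. Qed.

Lemma subrep_mapP s :
  (linfun subrep_map_fun \o ract (subrep stableU) s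
   = ract (subrep stableU') s \o linfun subrep_map_fun)%VF.
Proof.
apply/lfunP => u; apply: val_inj; rewrite !comp_lfunE [LHS]subrep_map_val.
by rewrite [RHS]subrep_act_val subrep_act_val rhom_eq subrep_map_val.
Qed.
Definition subrep_map : rhom (subrep stableU) (subrep stableU') :=
  RHom subrep_mapP.
End Subrep.

End RepIsomorphisms.

(** * Tensoring with the sign representation *)

Lemma tpureZr (k : fieldType) (U V : vectType k) (u : U) c (v : V) :
  tpure u (c *: v) = c *: tpure u v.
Proof.
apply/lfunP => phi; rewrite scale_lfunE !lfunE /= /tpure_fun.
by rewrite !scalerA mulrC.
Qed.

Section TensorSign.
Variables (k : fieldType) (m : nat) (M V W : rep k m).

Definition sgn_tens_fun (u : M) : tens M (sgnrep k m) := tpure u (1 : k^o).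

Lemma sgn_tens_linear : linear sgn_tens_fun.
Proof.
move=> c u v; apply/lfunP => phi.
by rewrite add_lfunE scale_lfunE !lfunE /= /tpure_fun linearP scalerDl scalerA.
Qed.
HB.instance Definition _ :=
  GRing.isLinear.Build k M (tens M (sgnrep k m)) _ sgn_tens_fun sgn_tens_linear.

(** Acting by s on u (x) 1 also multiplies the second factor by the sign of s; the scalar on the
    right undoes this. *)
Lemma sgn_tens_equivariant :
  sgn_equivariant (linfun sgn_tens_fun : 'Hom(M, tens M (sgnrep k m))).
Proof.
move=> s u.
have uE x : linfun sgn_tens_fun x = tpure x (1 : k^o) by rewrite lfunE.
rewrite !uE /= tmap_pure scale_lfunE lfunE /= tpureZr.
by rewrite scalerA -expr2 sqrr_sign scale1r.
Qed.

(** In the encoding of tensors as maps on the dual of [M], this is the biduality map of a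
    finite-dimensional space. The inverse reads off coordinates by evaluating at the dual basis
    [e]. *)
Lemma sgn_tens_bij : bijective (linfun sgn_tens_fun).
Proof.
pose b := vbasis {:M}.
pose e i : 'Hom(M, k^o) := linfun (coord b i : M -> k^o).
pose g (t : tens M (sgnrep k m)) : M := \sum_i (t (e i) : k) *: b`_i.
exists g => [u|t].
  rewrite /g [RHS](coord_vbasis (memvf u)); apply: eq_bigr => i _.
  rewrite !lfunE /= /tpure_fun lfunE /=; congr (_ *: _); apply: mulr1.
rewrite lfunE /= /sgn_tens_fun; apply/lfunP => phi.
rewrite lfunE /= /tpure_fun /g.
have {2}-> : phi = \sum_(i < \dim {:M}) (phi b`_i : k) *: e i.
  apply/lfunP => u; rewrite {1}(coord_vbasis (memvf u)) linear_sum sum_lfunE.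
  apply: eq_bigr => i _.
  by rewrite linearZ scale_lfunE lfunE /=; apply: mulrC.
rewrite !linear_sum scaler_suml; apply: eq_bigr => i _.
rewrite !linearZ /= -[LHS]/(t (e i) * phi b`_i * 1) mulr1; exact: mulrC.
Qed.

(** The isomorphism is the tensor product of u |-> u (x) 1 with [f]. Each factor commutes with s up
    to the sign of s, and the two signs cancel. *)
Lemma tens_sgn_iso (f : 'Hom(V, W)) : sgn_equivariant f -> bijective f ->
  rep_iso (tens M V) (tens (tens M (sgnrep k m)) W).
Proof.
move=> f_eq /bij_lfun_inv[g fK gK].
have [v uK vK] := bij_lfun_inv sgn_tens_bij.
pose Msgn := tens M (sgnrep k m).
pose u : 'Hom(M, Msgn) := linfun sgn_tens_fun.
pose h : 'Hom(tens M V, tens Msgn W) := tmap u f.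
have hP s : (h \o ract (tens M V) s = ract (tens Msgn W) s \o h)%VF.
  rewrite -!tmapM; apply/lfunP => t; apply/lfunP => phi.
  rewrite !tmapE !comp_lfunE f_eq.
  (* The sign of the first factor enters through the functional at which the tensor is evaluated. *)
  have -> : (phi \o (u \o ract M s)
             = (-1) ^+ odd_perm s *: (phi \o (ract Msgn s \o u)))%VF.
    apply/lfunP => x.
    by rewrite scale_lfunE !comp_lfunE sgn_tens_equivariant linearZ.
  by rewrite !linearZ /= scalerA -expr2 sqrr_sign scale1r.
apply: (bij_rep_iso (f := RHom hP)).
exists (tmap v g) => t; rewrite /= -comp_lfunE -tmapM.
  suff [-> ->] : (v \o u = \1)%VF /\ (g \o f = \1)%VF by rewrite tmap1 lfunE.
  by split; apply/lfunP => x; rewrite comp_lfunE id_lfunE ?uK ?fK.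
suff [-> ->] : (u \o v = \1)%VF /\ (f \o g = \1)%VF by rewrite tmap1 lfunE.
by split; apply/lfunP => x; rewrite comp_lfunE id_lfunE ?vK ?gK.
Qed.
End TensorSign.

(** * Isomorphisms of bisheaves and the functors P and Q *)

Lemma ds_comp0 (k : fieldType) (T : finType) (V : T -> vectType k) A j :
  ds_comp (0 : dsum V A) j = 0.
Proof. by rewrite /ds_comp; destruct idP; rewrite ?ffunE. Qed.

Section BisheafIsomorphisms.
Variables (k : fieldType) (m n : nat).
Implicit Types E F G : bisheaf k m n.
Implicit Types Phi Psi : ggm k m n.

Lemma biso_sym E F : biso E F -> biso F E.
Proof. by move=> [f [g fg]]; exists g, f => C; case: (fg C). Qed.

Section Composition.
Variables (E F G : bisheaf k m n) (g : bhom F G) (f : bhom E F).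

Lemma bhom_compP C s :
  ((g C \o f C) \o ract (E C) s = ract (G C) s \o (g C \o f C))%VF.
Proof. by rewrite -comp_lfunA rhomP !comp_lfunA rhomP. Qed.

Lemma bhom_comp_gam C D (h : cell_le C D) :
  ((g D \o f D) \o gam E h = gam G h \o (g C \o f C))%VF.
Proof. by rewrite -comp_lfunA bhom_gam !comp_lfunA bhom_gam. Qed.

Lemma bhom_comp_del C D (h : cell_le C D) :
  ((g C \o f C) \o del E h = del G h \o (g D \o f D))%VF.
Proof. by rewrite -comp_lfunA bhom_del !comp_lfunA bhom_del. Qed.

Definition bhom_comp : bhom E G :=
  @BHom _ _ _ E G (fun C => RHom (@bhom_compP C)) bhom_comp_gam bhom_comp_del.
End Composition.

Lemma biso_trans E F G : biso E F -> biso F G -> biso E G.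
Proof.
move=> [f [f' ff]] [g [g' gg]]; exists (bhom_comp g f), (bhom_comp f' g') => C.
have [fK f'K] := ff C; have [gK g'K] := gg C.
split; rewrite /= comp_lfunA -[X in (X \o _)%VF]comp_lfunA.
  by rewrite gK comp_lfun1r.
by rewrite f'K comp_lfun1r.
Qed.

Section DirectSumMap.
Variables (Phi Psi : ggm k m n) (h : forall I, rhom (Phi I) (Psi I)).

Section Stalk.
Variable A : pred {set 'I_n}.
Definition dsum_map_fun (f : sumrep Phi A) : sumrep Psi A :=
  [ffun i => h (val i) (f i)].
Lemma dsum_map_linear : linear dsum_map_fun.
Proof. by move=> c f g; apply/ffunP => i; rewrite ds_linE !ffunE linearP. Qed.
HB.instance Definition _ :=
  GRing.isLinear.Build k _ _ _ dsum_map_fun dsum_map_linear.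

Lemma dsum_map_comp f J : ds_comp (linfun dsum_map_fun f) J = h J (ds_comp f J).
Proof.
rewrite lfunE /= /ds_comp; destruct idP; first by rewrite ffunE.
by rewrite linear0.
Qed.

Lemma dsum_mapP s :
  (linfun dsum_map_fun \o ract (sumrep Phi A) s
   = ract (sumrep Psi A) s \o linfun dsum_map_fun)%VF.
Proof.
apply/lfunP => f; apply: ds_ext => J.
by rewrite !comp_lfunE dsum_map_comp !sum_act_comp dsum_map_comp rhom_eq.
Qed.
Definition dsum_map : rhom (sumrep Phi A) (sumrep Psi A) := RHom dsum_mapP.
End Stalk.

(** Taking [A] and [B] arbitrary covers the projections gamma and the embeddings delta together. *)
Lemma dsum_map_res A B :
  (dsum_map B \o sum_res Phi A B = sum_res Psi A B \o dsum_map A)%VF.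
Proof.
apply/lfunP => f; apply: ds_ext => J; rewrite !comp_lfunE dsum_map_comp.
rewrite [sum_res _ _ _ _]lfunE [sum_res _ _ _ _]lfunE /= !ds_comp_res.
by rewrite dsum_map_comp; case: ifP => // _; rewrite linear0.
Qed.

Definition qsheaf_map : bhom (qsheaf Phi) (qsheaf Psi) :=
  @BHom _ _ _ (qsheaf Phi) (qsheaf Psi) (fun C => dsum_map _)
    (fun C D _ => dsum_map_res _ _) (fun C D _ => dsum_map_res _ _).
End DirectSumMap.

Lemma qsheaf_iso Phi Psi :
  (forall I, rep_iso (Phi I) (Psi I)) -> biso (qsheaf Phi) (qsheaf Psi).
Proof.
(* There are finitely many sets I, so isomorphisms of all summands can be picked simultaneously. *)
move=> iso; have /fin_all_exists[h /fin_all_exists[h' hK]] := iso.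
exists (qsheaf_map h), (qsheaf_map h') => C.
split; apply/lfunP => f; apply: ds_ext => J; rewrite comp_lfunE id_lfunE.
  by rewrite !dsum_map_comp (hK J).1.
by rewrite !dsum_map_comp (hK J).2.
Qed.

Lemma p_spaceP E (I : {set 'I_n}) (u : E (pos_cell I)) : reflect
  (forall (J : {set 'I_n}) (sJI : J \proper I),
     gam E (pos_cell_le (proper_sub sJI)) u = 0)
  (u \in p_space E I).
Proof.
apply: (iffP idP) => [|u0].
  rewrite memvE => /subv_bigcapP uP J sJI.
  have := uP (exist _ J sJI) isT; rewrite -memvE memv_ker => /eqP <-.
  by congr (gam E _ u); apply: bool_irrelevance.
rewrite memvE; apply/subv_bigcapP => J _; rewrite -memvE memv_ker.
exact/eqP/u0.
Qed.

Lemma bhom_p_space E F (f : bhom E F) I u :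
  u \in p_space E I -> f (pos_cell I) u \in p_space F I.
Proof.
move/p_spaceP=> u0; apply/p_spaceP => J sJI.
by rewrite -comp_lfunE -bhom_gam comp_lfunE u0 linear0.
Qed.

(** Morphisms commute with gamma, so they preserve the common kernels. This lets P be computed on a
    bisheaf known only up to isomorphism with some Q(Phi). *)
Lemma pggm_iso E F I : biso E F -> rep_iso (pggm E I) (pggm F I).
Proof.
case=> f [g /(_ (pos_cell I))[/lfunP gf /lfunP fg]].
exists (subrep_map (@p_stable _ _ _ E I) (@p_stable _ _ _ F I)
  (@bhom_p_space _ _ f I)).
exists (subrep_map (@p_stable _ _ _ F I) (@p_stable _ _ _ E I)
  (@bhom_p_space _ _ g I)).
split=> u; apply: val_inj.
  rewrite /= !subrep_map_val; try exact: bhom_p_space.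
  by have := gf (vsval u); rewrite comp_lfunE id_lfunE.
rewrite /= !subrep_map_val; try exact: bhom_p_space.
by have := fg (vsval u); rewrite comp_lfunE id_lfunE.
Qed.

(** The map gamma to the cell of J keeps the component at J, so every component at a proper subset
    of I must vanish. The component at I is lost under each of these maps, so it is free. *)
Lemma p_space_qsheafP Phi I (u : qsheaf Phi (pos_cell I)) : reflect
  (forall J, J != I -> ds_comp u J = 0) (u \in p_space (qsheaf Phi) I).
Proof.
apply: (iffP (p_spaceP _)) => u0 J.
  move=> JI; have [sJI|nsJI] := boolP (J \subset I); last first.
    by rewrite ds_comp_out // zeros_pos_cell.
  have pJI : J \proper I by rewrite properEneq JI.
  have := congr1 (fun f => ds_comp f J) (u0 J pJI).
  by rewrite lfunE /= ds_comp_res zeros_pos_cell subxx => ->; apply: ds_comp0.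
move=> sJI; rewrite lfunE /=; apply: ds_ext => K.
rewrite [RHS]ds_comp0 ds_comp_res zeros_pos_cell.
case: ifP => // sKJ; apply: u0; apply: contraTneq sJI => <-.
by rewrite properE sKJ andbF.
Qed.

Section PQ.
Variables (Phi : ggm k m n) (I : {set 'I_n}).

Definition pggm_proj_fun (u : pggm (qsheaf Phi) I) : Phi I :=
  ds_comp (vsval u : dsum Phi _) I.
Lemma pggm_proj_linear : linear pggm_proj_fun.
Proof. by move=> c u v; rewrite /pggm_proj_fun linearP ds_comp_is_linear. Qed.
HB.instance Definition _ :=
  GRing.isLinear.Build k _ _ _ pggm_proj_fun pggm_proj_linear.

Lemma pggm_projP s :
  (linfun pggm_proj_fun \o ract (pggm (qsheaf Phi) I) s
   = ract (Phi I) s \o linfun pggm_proj_fun)%VF.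
Proof.
have projE u : linfun pggm_proj_fun u = ds_comp (vsval u : dsum Phi _) I.
  by rewrite lfunE.
apply/lfunP => u; rewrite !comp_lfunE !projE -sum_act_comp.
congr (ds_comp _ I).
exact: (@subrep_act_val _ _ (qsheaf Phi (pos_cell I)) _
  (@p_stable _ _ _ (qsheaf Phi) I)).
Qed.

Lemma pggm_qsheaf : rep_iso (pggm (qsheaf Phi) I) (Phi I).
Proof.
apply: (bij_rep_iso (f := RHom pggm_projP)).
(* The inverse puts [x] in the summand at [I] and zeros elsewhere. *)
pose single (x : Phi I) : qsheaf Phi (pos_cell I) :=
  [ffun i => dfwith (fun J => 0 : Phi J) x (val i)].
have single_comp (x : Phi I) J :
  ds_comp (single x) J = dfwith (fun J => 0 : Phi J) x J.
  rewrite ds_comp_finfun zeros_pos_cell; case: ifP => // /negbT nsJI.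
  by rewrite dfwith_out //; apply: contraNneq nsJI => ->.
have singleP x : single x \in p_space (qsheaf Phi) I.
  by apply/p_space_qsheafP => J JI; rewrite single_comp dfwith_out // eq_sym.
exists (fun x => vsproj _ (single x)) => [u|x].
  apply: val_inj; apply: (etrans (vsprojK (singleP _))).
  apply: ds_ext => J; rewrite single_comp.
  rewrite /= lfunE /= /pggm_proj_fun; have [->|JI] := eqVneq J I.
    by rewrite dfwith_in.
  by rewrite dfwith_out 1?eq_sym //; have /p_space_qsheafP-> := subvsP u.
by rewrite /= lfunE /= /pggm_proj_fun vsprojK // single_comp dfwith_in.
Qed.
End PQ.

End BisheafIsomorphisms.

(** * Ribbon modules and the Fourier-Sato transform *)

Section Ribbon.
Variables (k : fieldType) (n : nat).

Lemma a_eltE (I : {set 'I_n}) : a_elt k I = signed_sum k false (parabolic I).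
Proof.
apply/ffunP => w; rewrite sum_ffunE ffunE; under eq_bigr do rewrite ffunE.
case: ifP => wI; last first.
  by rewrite big1 // => v vI; case: eqP => // wv; rewrite wv vI in wI.
rewrite (bigD1 w) //= eqxx big1 ?addr0 // => v /andP[_ /negPf].
by rewrite eq_sym => ->.
Qed.

Lemma b_eltE (I : {set 'I_n}) : b_elt k I = signed_sum k true (parabolic I).
Proof.
apply/ffunP => w; rewrite sum_ffunE ffunE; under eq_bigr do rewrite !ffunE.
case: ifP => wI; last first.
  rewrite big1 // => v vI; case: eqP => [wv|_]; last exact: mulr0.
  by rewrite wv vI in wI.
rewrite (bigD1 w) //= eqxx big1 ?addr0 => [|v /andP[_ /negPf]].
  exact: mulr1.
by rewrite eq_sym => ->; rewrite scaler0.
Qed.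
End Ribbon.

Local Close Scope ring_scope.

Theorem theorem4p3p1 (k : fieldType) (char0 : [pchar k]%R =i pred0)
  (n : nat) (n_gt0 : 0 < n) (M : rep k n.+1) :
  hyp_iso (fourier_sato (ribbon_sheaf M))
          (ribbon_sheaf (tens M (sgnrep k n.+1))).
Proof.
(* Both sides are now of the form Q(Phi), so it suffices to compare summands. *)
apply: biso_trans (tens_qsheaf _ _); apply: qsheaf_iso => I.
(* Replacing M (x) Q(R) by Q(M (x) R) under P, and then P Q by the identity, leaves the summand M
   (x) R at the complement of [I]. *)
apply: rep_iso_trans (pggm_iso _ (biso_sym (tens_qsheaf _ _))) _.
apply: rep_iso_trans (pggm_qsheaf _ _) _.
(* The twisted map is used with [A] the parabolic subgroup of [I] and [B] that of its complement. *)
rewrite /fs_ggm /ribbon setCK !a_eltE !b_eltE.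
apply: (tens_sgn_iso _ (@twist_map_equivariant k n.+1 _ _)).
exact: twist_map_bij.
Qed.
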